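(* Let $\mathcal{C}\subset\mathbb{R}^d$ be a closed, pointed, convex cone and let $\mathfrak{L}(\mathcal{C})=\{\mathcal{L}_{\mathcal{C}}(x):x\in\mathcal{C}\}$ be the collection of its convex tangent spaces, partially ordered by inclusion. Then $\mathcal{C}$ is Terracini convex if and only if $\mathfrak{L}(\mathcal{C})$ is a join sub-semilattice of the lattice of all subspaces of $\mathbb{R}^d$ (i.e., the poset $\mathfrak{L}(\mathcal{C})$ has a join given by the sum of two subspaces; equivalently, $\mathfrak{L}(\mathcal{C})$ is closed under sums of two subspaces).
   Context: A convex cone $\mathcal{C}$ is pointed if $\mathcal{C}\cap(-\mathcal{C})=\{0\}$. For $x\in\mathcal{C}$, let $\mathcal{T}_{\mathcal{C}}(x)=\overline{\mathrm{cone}\{z-x:z\in\mathcal{C}\}}$ be the tangent cone and $\mathcal{L}_{\mathcal{C}}(x)=\mathcal{T}_{\mathcal{C}}(x)\cap(-\mathcal{T}_{\mathcal{C}}(x))$ the convex tangent space. $\mathcal{C}$ is $k$-Terracini convex if $\mathcal{L}_{\mathcal{C}}\big(\sum_{i=1}^kx^{(i)}\big)=\sum_{i=1}^k\mathcal{L}_{\mathcal{C}}(x^{(i)})$ for any collection $x^{(1)},\ldots,x^{(k)}$ of (not necessarily distinct) generators of extreme rays of $\mathcal{C}$; it is Terracini convex if it is $k$-Terracini convex for all $k$. In the lattice of subspaces of $\mathbb{R}^d$ the join of two subspaces is their sum and the meet is their intersection. *)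

(* Defs.v *)
From HB Require Import structures.
From mathcomp Require Import all_boot all_order all_algebra.
From mathcomp Require Import all_classical all_reals all_analysis.

Set Implicit Arguments.
Unset Strict Implicit.
Unset Printing Implicit Defensive.

Import Order.TTheory GRing.Theory Num.Theory.
Import numFieldNormedType.Exports.

Local Open Scope classical_set_scope.
Local Open Scope ring_scope.

Definition set_add (V : zmodType) (A B : set V) : set V :=
  [set a + b | a in A & b in B].

Definition set_opp (V : zmodType) (A : set V) : set V := [set - a | a in A].

Lemma set_addA (V : zmodType) : associative (@set_add V).
Proof.
move=> A B C; apply/seteqP; split=> v /=.
  move=> [a Aa [_ [b Bb [c Cc <-]] <-]].
  exists (a + b); first by exists a => //; exists b.
  by exists c => //; rewrite addrA.
move=> [_ [a Aa [b Bb <-]] [c Cc <-]].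
exists a => //; exists (b + c); last by rewrite addrA.
by exists b => //; exists c.
Qed.

Lemma set_addC (V : zmodType) : commutative (@set_add V).
Proof.
by move=> A B; apply/seteqP; split=> v /= [a Aa [b Bb <-]];
  exists b => //; exists a => //; rewrite addrC.
Qed.

Lemma set_add0 (V : zmodType) : left_id [set 0] (@set_add V).
Proof.
move=> A; apply/seteqP; split=> v /=.
  by move=> [_ -> [a Aa <-]]; rewrite add0r.
by move=> Av; exists 0 => //; exists v => //; rewrite add0r.
Qed.

HB.instance Definition _ (V : zmodType) :=
  Monoid.isComLaw.Build (set V) [set 0] (@set_add V)
    (@set_addA V) (@set_addC V) (@set_add0 V).

Section Cones.
Context {R : realType} {V : lmodType R}.
Implicit Types (A C F : set V) (x : V).

Definition cone_set A : Prop :=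
  forall (t : R) (v : V), 0 <= t -> A v -> A (t *: v).

Definition convex_cone A : Prop :=
  cone_set A /\ convex_set (A : set (convex_lmodType V)).

(* It forces 0 \in C, so a pointed cone is nonempty. *)
Definition pointed_cone C : Prop := C `&` set_opp C = [set 0].

(* All finite nonnegative combinations, including the empty one. *)
Definition conic_hull A : set V :=
  [set v | exists (n : nat) (t : 'I_n -> R) (a : 'I_n -> V),
     [/\ forall i, 0 <= t i, forall i, A (a i) & v = \sum_(i < n) t i *: a i]].

(* Faces of a convex cone C; as they are cones themselves, the usual condition
   on open segments amounts to the condition on sums below. *)
Definition face C F : Prop :=
  [/\ convex_cone F, F `<=` C &
      forall y z : V, C y -> C z -> F (y + z) -> F y /\ F z].

(* The ray spanned by x is a one-dimensional face of C. *)
Definition extreme_ray_generator C x : Prop :=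
  x != 0 /\ face C (conic_hull [set x]).

End Cones.

Definition subspaces (R : realType) (V : lmodType R) : set (set V) :=
  [set A | GRing.submod_closed [in A]].
Arguments subspaces {R} V.

Section TangentSpaces.
Context {R : realType} {d : nat}.
Implicit Types (C : set 'rV[R]_d) (x : 'rV[R]_d).

Definition tangent_cone C x : set 'rV[R]_d :=
  closure (conic_hull [set z - x | z in C]).

Definition convex_tangent_space C x : set 'rV[R]_d :=
  tangent_cone C x `&` set_opp (tangent_cone C x).

Definition convex_tangent_spaces C : set (set 'rV[R]_d) :=
  [set convex_tangent_space C x | x in C].

Definition k_Terracini_convex (k : nat) C : Prop :=
  forall x : 'I_k -> 'rV[R]_d,
    (forall i, extreme_ray_generator C (x i)) ->
    convex_tangent_space C (\sum_(i < k) x i) =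
    \big[@set_add _/[set 0]]_(i < k) convex_tangent_space C (x i).

Definition Terracini_convex C : Prop :=
  forall k : nat, (0 < k)%N -> k_Terracini_convex k C.

End TangentSpaces.

(* J is the least upper bound of A and B in the family P ordered by inclusion. *)
Definition is_join (T : Type) (P : set (set T)) (A B J : set T) : Prop :=
  [/\ P J, A `<=` J, B `<=` J &
      forall K, P K -> A `<=` K -> B `<=` K -> J `<=` K].

Definition join_subsemilattice (T : Type) (P L : set (set T)) : Prop :=
  L `<=` P /\ forall A B J, L A -> L B -> is_join P A B J -> L J.

Lemma is_join_subspaces_add (R : realType) (V : lmodType R) (A B : set V) :
  subspaces V A -> subspaces V B -> is_join (subspaces V) A B (set_add A B).
Proof.
move=> [] /[!inE] A0 Alin [] /[!inE] B0 Blin; split.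
- split; first by rewrite inE; exists 0 => //; exists 0 => //; rewrite addr0.
  move=> t u v /[!inE] -[a Aa [b Bb <-]] [a' Aa' [b' Bb' <-]].
  have := Alin t a a'; have := Blin t b b'; rewrite !inE => Bt At.
  exists (t *: a + a'); first exact: At.
  by exists (t *: b + b'); [exact: Bt|rewrite scalerDr addrACA].
- by move=> a Aa; exists a => //; exists 0 => //; rewrite addr0.
- by move=> b Bb; exists 0 => //; exists b => //; rewrite add0r.
- move=> K [] _ Klin AK BK _ [a Aa [b Bb <-]].
  have := Klin 1 a b; rewrite scale1r !inE; apply; [exact: AK|exact: BK].
Qed.

(* Main.v *)
(** The tangent cone T(x) is the least closed convex cone containing C and -x,
    so L(x) is included in L(z) as soon as x lies in L(z). Hence
    L(x) + L(y) is always included in L(x + y), and if L(x) + L(y) = L(z) then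
    x + y lies in L(z), which gives L(x + y) = L(x) + L(y). This settles
    "closed under sums implies Terracini convex".

    For the converse, every point of C is a finite sum of extreme ray generators
    (Minkowski). If x is not extreme, choose y in its minimal face, not
    proportional to x, and let y' = y - s x and x' = x - t y' with s and then t
    maximal for membership in C. The minimal faces of x' and y' both span less
    than that of x, and x = x' + t y', so induction on dimension applies. *)
Require Import Defs.
From mathcomp Require Import all_boot all_order all_algebra.
From mathcomp Require Import all_classical all_reals all_analysis.
From mathcomp Require Import lra.
Import Order.TTheory GRing.Theory Num.Theory.
Import numFieldNormedType.Exports.
Local Open Scope classical_set_scope.
Local Open Scope ring_scope.

(** * Convex cones and conic hulls *)

Section ConvexCones.
Context {R : realType} {V : lmodType R}.
Implicit Types (A C K : set V) (x y : V).

(** The sum is twice the midpoint. *)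
Lemma convex_coneD C x y : convex_cone C -> C x -> C y -> C (x + y).
Proof.
move=> [coneC cvxC] Cx Cy.
have h0 : (0 <= 2^-1 :> R) by lra.
have h1 : (2^-1 <= 1 :> R) by lra.
have /set_mem Cm : conv (Itv01 h0 h1) (x : convex_lmodType V) y \in C.
  by apply: cvxC; exact: mem_set.
have -> : x + y = 2 *: conv (Itv01 h0 h1) (x : convex_lmodType V) y.
  rewrite /conv /= scalerDr !scalerA /= /unstable.onem.
  by rewrite mulrBr mulr1 divff // addrK !scale1r.
by apply: coneC => //; lra.
Qed.

Lemma convex_coneZ C t x : convex_cone C -> 0 <= t -> C x -> C (t *: x).
Proof. by move=> [coneC _]; exact: coneC. Qed.

Lemma convex_cone0 C x : convex_cone C -> C x -> C 0.
Proof. by move=> cC Cx; rewrite -(scale0r x); exact: convex_coneZ. Qed.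

Lemma convex_cone_add_closed C : cone_set C ->
  (forall x y, C x -> C y -> C (x + y)) -> convex_cone C.
Proof.
move=> coneC addC; split=> // x y l /set_mem Cx /set_mem Cy.
by apply/mem_set/addC; apply: coneC => //; rewrite subr_ge0.
Qed.

Lemma conic_hull_sub A K :
  convex_cone K -> K 0 -> A `<=` K -> conic_hull A `<=` K.
Proof.
move=> cK K0 AK v [n [t [a [t0 Aa ->]]]].
by apply: (big_ind K) => // [x y|i _]; [exact: convex_coneD|
  apply: convex_coneZ => //; exact: AK].
Qed.

Lemma convex_cone_ray x : convex_cone [set t *: x | t in [set t : R | 0 <= t]].
Proof.
apply: convex_cone_add_closed => [t _ t0 [s s0 <-]|_ _ [s s0 <-] [t t0 <-]].
  by exists (t * s); rewrite ?scalerA //= mulr_ge0.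
by exists (s + t); rewrite ?scalerDl //= addr_ge0.
Qed.

Lemma conic_hull1 x :
  conic_hull [set x] = [set t *: x | t in [set t : R | 0 <= t]].
Proof.
apply/seteqP; split=> v.
  apply: conic_hull_sub => [||_ ->].
  - exact: convex_cone_ray.
  - by exists 0; rewrite ?scale0r //=.
  - by exists 1; rewrite ?scale1r //=.
move=> [t t0 <-]; exists 1%N, (fun=> t), (fun=> x); split=> //.
by rewrite big_ord1.
Qed.

Lemma convex_cone_translate C x : convex_cone C ->
  convex_cone [set v | exists2 s : R, 0 <= s & C (v + s *: x)].
Proof.
move=> cC.
apply: convex_cone_add_closed => [t u t0 [s s0 Cu]|u w [s s0 Cu] [t t0 Cw]].
  exists (t * s); first exact: mulr_ge0.
  by rewrite -scalerA -scalerDr; exact: convex_coneZ.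
exists (s + t); first exact: addr_ge0.
by rewrite scalerDl addrACA; exact: convex_coneD.
Qed.

(** The right-hand side is the cone of all c - s x with c in [C] and s nonnegative. It replaces
    finite combinations by a single scalar in all later work with tangent cones. *)
Lemma conic_hull_translate C x : convex_cone C -> C x ->
  conic_hull [set z - x | z in C] =
  [set v | exists2 s : R, 0 <= s & C (v + s *: x)].
Proof.
move=> cC Cx; apply/seteqP; split=> v.
  apply: conic_hull_sub => [||_ [z Cz <-]].
  - exact: convex_cone_translate.
  - by exists 0 => //; rewrite scale0r addr0; exact: convex_cone0 Cx.
  - by exists 1 => //; rewrite scale1r subrK.
(* Here v = (s + 1) (z - x) with z = (v + s x + x) / (s + 1). The factor s + 1 is positive even when
   s = 0. *)
move=> [s s0 Cv]; have s1 : 0 < s + 1 by lra.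
exists 1%N, (fun=> s + 1), (fun=> (s + 1)^-1 *: (v + s *: x + x) - x).
split=> [_|_|]; first exact: ltW.
  exists ((s + 1)^-1 *: (v + s *: x + x)) => //; apply: convex_coneZ => //.
    by rewrite invr_ge0 ltW.
  exact: convex_coneD.
rewrite big_ord1 scalerBr scalerA divff ?gt_eqF // scale1r scalerDl scale1r.
by rewrite -(addrA v) addrK.
Qed.

End ConvexCones.

(** * Closed convex cones in normed spaces *)

Lemma closure_preimage_sub (S T : topologicalType) (f : S -> T) (A : set S)
    (B : set T) :
  continuous f -> A `<=` f @^-1` B -> closure A `<=` f @^-1` (closure B).
Proof.
move=> cf AB.
have /closure_id -> : closed (f @^-1` closure B).
  by apply: (continuous_closedP f).1 => //; exact: closed_closure.
by apply: closureS => x Ax; exact: (@subset_closure _ B _ (AB _ Ax)).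
Qed.

Section ClosedCones.
Context {R : realType} {V : normedModType R}.
Implicit Types (A C : set V) (x y : V).

Lemma closure_convex_cone A : convex_cone A -> convex_cone (closure A).
Proof.
move=> cA.
have trans_cont y : continuous (fun x : V => x + y).
  by move=> x; apply: cvgD; [exact: cvg_id|exact: cvg_cst].
apply: convex_cone_add_closed => [t v t0|x y Ax Ay].
  apply: (closure_preimage_sub _ _ ( *:%R t)); first exact: scaler_continuous.
  by move=> u; exact: convex_coneZ.
(* Closure under addition is obtained one variable at a time: first one summand in [A], then, since
   [closure] is idempotent, both in [closure A]. *)
have step z u : A z -> closure A u -> closure A (u + z).
  move=> Az; apply: (closure_preimage_sub _ _ (+%R^~ z)) => // w Aw.
  exact: convex_coneD.
have [] := @closure_id _ (closure A) => /(_ (@closed_closure _ _)) -> _.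
apply: (closure_preimage_sub _ _ (+%R^~ y)) Ax => // z Az.
by rewrite /preimage /= addrC; exact: step.
Qed.

(** The parameters t with a - t b in [C] form a closed set containing 0. It is bounded above because
    [C] is closed and misses - b, so its supremum is the required t. *)
Lemma last_point_on_ray C a b : convex_cone C -> closed C -> C a -> ~ C (- b) ->
  exists t : R, [/\ 0 <= t, C (a - t *: b) &
    forall e, 0 < e -> ~ C (a - (t + e) *: b)].
Proof.
move=> cC clC Ca nCb.
pose S := [set t : R | C (a - t *: b)].
have clS : closed S.
  apply: (continuous_closedP (fun t : R => a - t *: b)).1 => // t.
  by apply: cvgB; [exact: cvg_cst|exact: scalel_continuous].
have S0 : S 0 by rewrite /S /= scale0r subr0.
(* For t > 0 in [S], dividing by t puts t^-1 a - b in [C]. This fails for t^-1 in some ball of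
   radius e around 0, so e^-1 bounds [S]. *)
have [M M0 SM] : exists2 M : R, 0 < M & ubound S M.
  have : closed [set u : R | C (u *: a - b)].
    apply: (continuous_closedP (fun u : R => u *: a - b)).1 => // u.
    by apply: cvgB; [exact: scalel_continuous|exact: cvg_cst].
  rewrite -openC openE => /(_ 0); rewrite /= scale0r sub0r => /(_ nCb).
  move=> /nbhs_ballP [e /= e0 He].
  exists (e^-1); first by rewrite invr_gt0.
  move=> t St; rewrite leNgt; apply/negP => et.
  have t0 : 0 < t by apply: lt_trans et; rewrite invr_gt0.
  apply: (He t^-1).
    rewrite /ball /= sub0r normrN gtr0_norm ?invr_gt0 //.
    by rewrite -[e]invrK ltf_pV2 // posrE ?invr_gt0.
  rewrite /=; have -> : t^-1 *: a - b = t^-1 *: (a - t *: b).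
    by rewrite scalerBr scalerA mulVf ?gt_eqF // scale1r.
  by apply: convex_coneZ => //; rewrite invr_ge0 ltW.
have ubS : has_ubound S by exists M.
have supS : S (sup S).
  by rewrite {1}((closure_id S).1 clS); apply: closure_sup => //; exists 0.
exists (sup S); split=> //; first exact: ub_le_sup.
by move=> e e0 /(ub_le_sup ubS); lra.
Qed.

End ClosedCones.

(** * Linear spans of minimal faces *)

Section FaceSpan.
Context {R : realType} {V : lmodType R}.
Implicit Types (C : set V) (x y v w : V).

(* For [x] in the convex cone [C] this is the linear span of the smallest face
   of [C] containing [x]. *)
Definition face_span C x : set V :=
  [set v | exists2 s : R, 0 <= s & C (s *: x + v) /\ C (s *: x - v)].

Variables (C : set V) (cC : convex_cone C).

Lemma face_spanD x v w :
  face_span C x v -> face_span C x w -> face_span C x (v + w).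
Proof.
move=> [s s0 [Cv Cv']] [t t0 [Cw Cw']]; exists (s + t); first exact: addr_ge0.
by rewrite scalerDl opprD; split; rewrite addrACA; exact: convex_coneD.
Qed.

Lemma face_spanZ x t v : face_span C x v -> face_span C x (t *: v).
Proof.
move=> [s s0 [Cv Cv']]; exists (`|t| * s); first exact: mulr_ge0.
have E : C (`|t| *: (s *: x + v)) /\ C (`|t| *: (s *: x - v)).
  by split; exact: convex_coneZ.
(* A negative t exchanges the two membership conditions. *)
move: E; rewrite !scalerDr scalerN scalerA; have [t0|t0] := leP 0 t.
  by rewrite (ger0_norm t0).
by rewrite (ltr0_norm t0) !scaleNr opprK => -[].
Qed.

Lemma face_span_sum x n (v : 'I_n -> V) (t : 'I_n -> R) : C x ->
  (forall i, face_span C x (v i)) -> face_span C x (\sum_i t i *: v i).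
Proof.
move=> Cx Dv; apply: big_ind => [|v1 v2|i _].
- by exists 0; rewrite ?scale0r ?subr0 ?addr0 //; split; exact: convex_cone0 Cx.
- exact: face_spanD.
- exact: face_spanZ.
Qed.

Lemma face_span_self x : C x -> face_span C x x.
Proof.
move=> Cx; exists 1 => //; rewrite scale1r subrr.
by split; [exact: convex_coneD|exact: convex_cone0 Cx].
Qed.

Lemma face_span_trans x y : face_span C x y -> face_span C y `<=` face_span C x.
Proof.
move=> [s s0 [_ Cy]] v [t t0 [Cv Cv']].
exists (t * s); first exact: mulr_ge0.
have E w : C (t *: y + w) -> C ((t * s) *: x + w).
  move=> Cw; have -> : (t * s) *: x + w = t *: (s *: x - y) + (t *: y + w).
    by rewrite scalerBr scalerA addrA subrK.
  by apply: convex_coneD => //; exact: convex_coneZ.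
by split; exact: E.
Qed.

Lemma face_span_addl x y : C x -> C y -> face_span C (x + y) x.
Proof.
move=> Cx Cy; exists 1 => //; rewrite scale1r; split.
  by apply: convex_coneD => //; exact: convex_coneD.
by rewrite addrAC subrr add0r.
Qed.

(** If s x - v were in [C], adding x and dividing by s + 1 would put x - v / (s + 1) in [C]. *)
Lemma not_face_span x v : C x ->
  (forall e, 0 < e -> ~ C (x - e *: v)) -> ~ face_span C x v.
Proof.
move=> Cx nC [s s0 [_ Cv]].
have s1 : 0 < s + 1 by lra.
apply: (nC (s + 1)^-1); first by rewrite invr_gt0.
have -> : x - (s + 1)^-1 *: v = (s + 1)^-1 *: (x + (s *: x - v)).
  rewrite addrA -{2}[x]scale1r -scalerDl [1 + s]addrC scalerBr scalerA.
  by rewrite mulVf ?gt_eqF // scale1r.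
by apply: convex_coneZ; [|rewrite invr_ge0 ltW|exact: convex_coneD].
Qed.

End FaceSpan.

(** * Extreme rays of a pointed cone *)

Section ExtremeRays.
Context {R : realType} {V : lmodType R}.
Implicit Types (x y v : V).
Variables (C : set V) (cC : convex_cone C) (pC : pointed_cone C).

Lemma pointed_cone_eq0 x : C x -> C (- x) -> x = 0.
Proof.
move=> Cx CNx; have : (C `&` set_opp C) x.
  by split => //; exists (- x); rewrite ?opprK.
by rewrite pC.
Qed.

Lemma extreme_ray_generator_in x : extreme_ray_generator C x -> C x.
Proof.
move=> [_ [_ sub _]]; apply: sub; rewrite conic_hull1.
by exists 1; rewrite ?scale1r //= ler01.
Qed.

Lemma extreme_ray_generatorZ t x : 0 < t ->
  extreme_ray_generator C x -> extreme_ray_generator C (t *: x).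
Proof.
move=> t0 [x0 fx]; split; first by rewrite scaler_eq0 negb_or gt_eqF.
suff -> : conic_hull [set t *: x] = conic_hull [set x] by [].
rewrite !conic_hull1; apply/seteqP; split=> _ [s s0 <-].
  by exists (s * t); rewrite -?scalerA //= mulr_ge0 // ltW.
exists (s / t); first by rewrite /= divr_ge0 // ltW.
by rewrite scalerA divfK ?gt_eqF.
Qed.

(** If y + z is on the ray, then y and z lie in the face span of x, hence are multiples of x;
    pointedness makes the coefficients nonnegative. *)
Lemma extreme_ray_generator_intro x : C x -> x != 0 ->
  (forall y, C y -> face_span C x y -> exists t : R, y = t *: x) ->
  extreme_ray_generator C x.
Proof.
move=> Cx x0 Hx; split=> //.
have nneg t : C (t *: x) -> 0 <= t.
  move=> Ct; rewrite leNgt; apply/negP => t0; move/eqP: x0; apply.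
  apply: pointed_cone_eq0 => //.
  have -> : - x = (- t)^-1 *: (t *: x).
    by rewrite scalerA invrN mulNr mulVf ?lt_eqF // scaleN1r.
  by apply: convex_coneZ => //; rewrite invr_ge0; lra.
rewrite conic_hull1; split.
- exact: convex_cone_ray.
- by move=> _ [t t0 <-]; exact: convex_coneZ.
have main y z : C y -> C z -> face_span C x (y + z) ->
    [set t *: x | t in [set t : R | 0 <= t]] y.
  move=> Cy Cz Dyz; have [t yt] : exists t : R, y = t *: x.
    apply: Hx => //; apply: face_span_trans Dyz _ _ => //.
    exact: face_span_addl.
  by exists t => //; apply: nneg; rewrite -yt.
move=> y z Cy Cz [t _ tyz].
have Dyz : face_span C x (y + z).
  by rewrite -tyz; apply: face_spanZ => //; exact: face_span_self.
by split; [apply: (main y z)|apply: (main z y) => //; rewrite addrC].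
Qed.

End ExtremeRays.

(** * Decomposition into sums of extreme ray generators *)

Section Minkowski.
Context {R : realType} {d : nat}.
Variables (C : set 'rV[R]_d).
Hypotheses (cC : convex_cone C) (clC : closed C) (pC : pointed_cone C).
Implicit Types (x y v : 'rV[R]_d).

(** Bounds the dimension of [face_span C x] through its free families, so that no [{vspace _}] has
    to be built from this set. *)
Let rank_le n x := forall s : seq 'rV[R]_d, free s ->
  (forall v, v \in s -> face_span C x v) -> (size s <= n)%N.

(** A free family in the face span of y stays free when v is added, and the enlarged family lies in
    the face span of x. *)
Let rank_le_face n x y v : C x -> C y -> rank_le n.+1 x ->
  face_span C x y -> face_span C x v -> ~ face_span C y v -> rank_le n y.
Proof.
move=> Cx Cy rx Dxy Dxv nDyv s fs Ds; apply: (rx (v :: s)).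
  rewrite free_cons fs andbT; apply/negP.
  move=> /(@coord_span _ _ _ (in_tuple s)) vE.
  by apply: nDyv; rewrite vE; apply: face_span_sum => // i; apply/Ds/mem_nth.
move=> w; rewrite inE => /orP[/eqP -> //|/Ds].
exact: face_span_trans.
Qed.

Let sum_extreme x := exists2 s : seq 'rV[R]_d,
  forall v, v \in s -> extreme_ray_generator C v & x = \sum_(v <- s) v.

Let sum_extremeD x y : sum_extreme x -> sum_extreme y -> sum_extreme (x + y).
Proof.
move=> [s es ->] [t et ->]; exists (s ++ t); last by rewrite big_cat.
by move=> v; rewrite mem_cat => /orP[/es|/et].
Qed.

Let sum_extremeZ t x : 0 <= t -> sum_extreme x -> sum_extreme (t *: x).
Proof.
rewrite le_eqVlt => /orP[/eqP <- _|t0 [s es ->]].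
  by exists [::] => //; rewrite big_nil scale0r.
exists [seq t *: v | v <- s]; last by rewrite big_map scaler_sumr.
by move=> _ /mapP[v /es ev ->]; exact: extreme_ray_generatorZ.
Qed.

Let sum_extreme_rank n x : C x -> rank_le n x -> sum_extreme x.
Proof.
elim: n x => [|n IH] x Cx rx; have [->|x0] := eqVneq x 0.
- by exists [::] => //; rewrite big_nil.
(* With rank bound 0, a nonzero x would itself be a free family of size 1. *)
- suff : (size [:: x] <= 0)%N by [].
  apply: rx; first by rewrite seq1_free.
  by move=> v; rewrite inE => /eqP ->; exact: face_span_self.
- by exists [::] => //; rewrite big_nil.
have [Hx|] := pselect (forall y, C y -> face_span C x y ->
    exists t : R, y = t *: x).
  exists [:: x]; last by rewrite big_seq1.
  by move=> v; rewrite inE => /eqP ->; exact: extreme_ray_generator_intro.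
move=> /existsNP[y /not_implyP[Cy /not_implyP[Dxy nyx]]].
have Dxx : face_span C x x by exact: face_span_self.
have [|s [s0 Cy' smax]] := last_point_on_ray _ y x cC clC Cy.
  by move=> CNx; move/eqP: x0; apply; exact: pointed_cone_eq0 CNx.
set y' := y - s *: x in Cy'.
have Dxy' : face_span C x y'.
  by apply: face_spanD => //; rewrite -scaleNr; exact: face_spanZ.
(* By maximality of s, no positive multiple of x can be subtracted from [y'] within [C]. *)
have nDy' : ~ face_span C y' x.
  by apply: not_face_span => // e e0; rewrite -addrA -opprD -scalerDl;
    exact: smax.
have sy' : sum_extreme y'.
  by apply: IH => //; apply: rank_le_face rx Dxy' Dxx nDy'.
(* If - [y'] were in [C], pointedness would give [y'] = 0, that is y = s x, against the choice of
   y. *)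
have [|t [t0 Cx' tmax]] := last_point_on_ray _ x y' cC clC Cx.
  move=> /(pointed_cone_eq0 _ pC _ Cy') /eqP; rewrite subr_eq0 => /eqP yE.
  by apply: nyx; exists s.
set x' := x - t *: y' in Cx'.
have xE : x = x' + t *: y' by rewrite subrK.
have nDx' : ~ face_span C x' y'.
  by apply: not_face_span => // e e0; rewrite -addrA -opprD -scalerDl;
    exact: tmax.
have Dxx' : face_span C x x'.
  by rewrite {1}xE; apply: face_span_addl => //; exact: convex_coneZ.
rewrite xE; apply: sum_extremeD; last exact: sum_extremeZ.
by apply: IH => //; apply: rank_le_face rx Dxx' Dxy' nDx'.
Qed.

Lemma closed_pointed_cone_Minkowski x : C x -> exists2 s : seq 'rV[R]_d,
  forall v, v \in s -> extreme_ray_generator C v & x = \sum_(v <- s) v.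
Proof.
move=> Cx; apply: (sum_extreme_rank (\dim {: 'rV[R]_d})%VS) => // s fs _.
by move: fs; rewrite /free => /eqP <-; exact/dimvS/subvf.
Qed.

End Minkowski.

(** * Tangent cones and convex tangent spaces *)

Section Tangent.
Context {R : realType} {d : nat}.
Variables (C : set 'rV[R]_d) (cC : convex_cone C).
Implicit Types (x y z v : 'rV[R]_d).
Local Notation T := (tangent_cone C).
Local Notation L := (convex_tangent_space C).

Lemma tangent_cone_convex x : C x -> convex_cone (T x).
Proof.
move=> Cx; apply: closure_convex_cone; rewrite conic_hull_translate //.
exact: convex_cone_translate.
Qed.

Lemma sub_tangent_cone x : C x -> C `<=` T x.
Proof.
move=> Cx y Cy; apply: subset_closure; rewrite conic_hull_translate //.
by exists 0; rewrite ?scale0r ?addr0.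
Qed.

Lemma tangent_coneN x : C x -> T x (- x).
Proof.
move=> Cx; apply: subset_closure; rewrite conic_hull_translate //.
by exists 1; rewrite // scale1r addNr; exact: convex_cone0 Cx.
Qed.

Lemma tangent_cone_sub x (K : set 'rV[R]_d) : C x -> convex_cone K ->
  closed K -> C `<=` K -> K (- x) -> T x `<=` K.
Proof.
move=> Cx cK clK CK Kx; rewrite ((closure_id K).1 clK); apply: closureS.
rewrite conic_hull_translate // => v [s s0 /CK Kv].
have -> : v = (v + s *: x) + s *: (- x) by rewrite scalerN addrK.
by apply: convex_coneD => //; exact: convex_coneZ.
Qed.

Lemma convex_tangent_spaceE x v : L x v <-> T x v /\ T x (- v).
Proof.
split=> [[Tv [w Tw wv]]|[Tv TNv]]; first by rewrite -wv opprK wv.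
by split=> //; exists (- v); rewrite ?opprK.
Qed.

Lemma convex_tangent_space_self x : C x -> L x x.
Proof.
move=> Cx; apply/convex_tangent_spaceE; split; first exact: sub_tangent_cone.
exact: tangent_coneN.
Qed.

(** [T z] is a closed convex cone containing [C] and - x, so it contains [T x] by minimality. *)
Lemma convex_tangent_space_le x z : C x -> C z -> L z x -> L x `<=` L z.
Proof.
move=> Cx Cz /convex_tangent_spaceE[_ TNx].
have TT : T x `<=` T z.
  apply: tangent_cone_sub => //; first exact: tangent_cone_convex.
    exact: closed_closure.
  exact: sub_tangent_cone.
by move=> v /convex_tangent_spaceE[/TT ? /TT ?]; exact/convex_tangent_spaceE.
Qed.

Lemma convex_tangent_spaceD_in x u v : C x -> L x u -> L x v -> L x (u + v).
Proof.
move=> Cx /convex_tangent_spaceE[Tu Tu'] /convex_tangent_spaceE[Tv Tv'].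
have cT := tangent_cone_convex _ Cx.
apply/convex_tangent_spaceE; rewrite opprD; split.
  exact: (convex_coneD _ _ _ cT Tu Tv).
exact: (convex_coneD _ _ _ cT Tu' Tv').
Qed.

Lemma convex_tangent_spaceZ_in x t v : C x -> L x v -> L x (t *: v).
Proof.
move=> Cx /convex_tangent_spaceE[Tv Tv']; apply/convex_tangent_spaceE.
have cT := tangent_cone_convex _ Cx.
have [t0|t0] := leP 0 t; first by rewrite -scalerN; split;
  exact: (convex_coneZ _ _ _ cT).
rewrite -[t *: v]opprK -scaleNr opprK -scalerN.
by split; apply: (convex_coneZ _ _ _ cT) => //; lra.
Qed.

Lemma convex_tangent_spaces_sub :
  convex_tangent_spaces C `<=` subspaces 'rV[R]_d.
Proof.
move=> _ [x Cx <-]; split.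
  rewrite inE -(scale0r x); apply: convex_tangent_spaceZ_in => //.
  exact: convex_tangent_space_self.
move=> t u v; rewrite !inE => Lu Lv; apply: convex_tangent_spaceD_in => //.
exact: convex_tangent_spaceZ_in.
Qed.

Lemma set_add_convex_tangent_space_sub x y : C x -> C y ->
  set_add (L x) (L y) `<=` L (x + y).
Proof.
move=> Cx Cy _ [u Lu [v Lv <-]].
have Cxy : C (x + y) by exact: convex_coneD.
have mono a b : C a -> C b -> C (a + b) -> L a `<=` L (a + b).
  move=> Ca Cb Cab; apply: convex_tangent_space_le => //.
  (* It remains to put - a in the tangent cone at a + b: it is b plus - (a + b), both of which lie
     there. *)
  apply/convex_tangent_spaceE; split; first exact: sub_tangent_cone.
  have -> : - a = b + - (a + b) by rewrite opprD addrC subrK.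
  apply: (convex_coneD _ _ _ (tangent_cone_convex _ Cab)).
    exact: sub_tangent_cone.
  exact: tangent_coneN.
apply: convex_tangent_spaceD_in => //; first exact: mono Lu.
by rewrite addrC; apply: mono Lv; rewrite // addrC.
Qed.

Lemma convex_tangent_spaceD x y : C x -> C y ->
  convex_tangent_spaces C (set_add (L x) (L y)) ->
  L (x + y) = set_add (L x) (L y).
Proof.
move=> Cx Cy [z Cz Lz]; apply/seteqP; split; last first.
  exact: set_add_convex_tangent_space_sub.
rewrite -Lz; apply: convex_tangent_space_le => //; first exact: convex_coneD.
by rewrite Lz; exists x; [exact: convex_tangent_space_self|];
  exists y => //; exact: convex_tangent_space_self.
Qed.

(** Since [C] is closed, its tangent cone at 0 is [C] itself. The result is the unit of [set_add],
    which settles empty sums. *)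
Lemma convex_tangent_space0 : closed C -> pointed_cone C -> L 0 = [set 0].
Proof.
move=> clC pC; have C0 : C 0 by have [] : (C `&` set_opp C) 0 by rewrite pC.
have T0 : T 0 = C.
  apply/seteqP; split; last exact: sub_tangent_cone.
  by apply: tangent_cone_sub; rewrite ?oppr0.
by rewrite /convex_tangent_space T0.
Qed.

End Tangent.

(** * Joins and the equivalences *)

Lemma is_join_uniq (T : Type) (P : set (set T)) A B J K :
  is_join P A B J -> is_join P A B K -> J = K.
Proof.
move=> [PJ AJ BJ minJ] [PK AK BK minK].
by apply/seteqP; split; [exact: minJ|exact: minK].
Qed.

Theorem proposition2p5 (R : realType) (d : nat) (C : set 'rV[R]_d)
    (convC : convex_cone C) (closedC : closed C) (pointedC : pointed_cone C) :
  [/\ Terracini_convex C <->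
        join_subsemilattice (subspaces 'rV[R]_d)
          (convex_tangent_spaces C),
      join_subsemilattice (subspaces 'rV[R]_d)
          (convex_tangent_spaces C) <->
        (forall A B : set 'rV[R]_d,
           convex_tangent_spaces C A -> convex_tangent_spaces C B ->
           is_join (convex_tangent_spaces C) A B (set_add A B)) &
      join_subsemilattice (subspaces 'rV[R]_d)
          (convex_tangent_spaces C) <->
        (forall A B : set 'rV[R]_d,
           convex_tangent_spaces C A -> convex_tangent_spaces C B ->
           convex_tangent_spaces C (set_add A B))].
Proof.
have sub := convex_tangent_spaces_sub _ convC.
have C0 : C 0 by have [] : (C `&` set_opp C) 0 by rewrite pointedC.
have L0 := convex_tangent_space0 _ convC closedC pointedC.
(* All three equivalences pass through closure under sums. Uniqueness of joins identifies the join
   of two subspaces with their sum. *)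
set closedL := (X in [/\ _, _ & _ <-> X]).
have semiP : join_subsemilattice (subspaces 'rV[R]_d)
    (convex_tangent_spaces C) <-> closedL.
  split=> [[_ H] A B LA LB|H].
    by apply: (H A B) => //; apply: is_join_subspaces_add; exact: sub.
  split=> // A B J LA LB joinJ.
  have := is_join_subspaces_add (sub _ LA) (sub _ LB).
  by move=> /is_join_uniq /(_ joinJ) <-; exact: H.
split=> //; last first.
  rewrite semiP; split=> H A B LA LB; last by have [] := H A B LA LB.
  (* Minimality among all subspaces restricts to the smaller family of tangent spaces. *)
  have [_ AJ BJ minJ] := is_join_subspaces_add (sub _ LA) (sub _ LB).
  by split=> // [|K /sub]; [exact: H|exact: minJ].
rewrite semiP; split=> [TC _ _ [x Cx <-] [y Cy <-]|H k _ x ex].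
  (* Terracini convexity speaks of k > 0; the empty list, which decomposes the point 0, is covered
     by [L0]. *)
  have Lsum s : (forall v, v \in s -> extreme_ray_generator C v) ->
      convex_tangent_space C (\sum_(v <- s) v) =
      \big[@set_add _/[set 0]]_(v <- s) convex_tangent_space C v.
    case: s => [|a s] es; first by rewrite !big_nil.
    by rewrite big_tnth [RHS]big_tnth; apply: TC => // i; apply/es/mem_tnth.
  have [s es xE] := closed_pointed_cone_Minkowski _ convC closedC pointedC _ Cx.
  have [t et yE] := closed_pointed_cone_Minkowski _ convC closedC pointedC _ Cy.
  exists (x + y); first exact: convex_coneD.
  (* The concatenated list of generators sums to x + y, and [Lsum] applies to it and to both of its
     halves. *)
  rewrite xE yE -big_cat !Lsum ?big_cat // => v.
  by rewrite mem_cat => /orP[/es|/et].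
(* Membership of the partial sums in [C] is carried along, as [convex_tangent_spaceD] needs it at
   each addition. *)
suff [] : C (\sum_(i < k) x i) /\ convex_tangent_space C (\sum_(i < k) x i) =
    \big[@set_add _/[set 0]]_(i < k) convex_tangent_space C (x i) by [].
apply: (big_ind2 (fun v A => C v /\ convex_tangent_space C v = A)) => //.
  move=> v A w B [Cv <-] [Cw <-]; split; first exact: convex_coneD.
  by apply: convex_tangent_spaceD => //; apply: H; [exists v|exists w].
by move=> i _; split=> //; exact: extreme_ray_generator_in.
Qed.
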